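(* Let $B\in\mathbb{C}^{m\times n}$, $\tilde W\in\mathbb{C}^{n\times m}$ and $\tilde k=\mathrm{ind}(B\tilde W)$. Suppose $X\in\mathbb{C}^{m\times n}$ is a minimal rank $W$-weighted weak Drazin inverse of $B$. Then $Y=B^{\dagger}B\tilde W X\tilde W$ is the unique matrix $Y\in\mathbb{C}^{n\times m}$ satisfying $$BY=P_{\mathcal R((B\tilde W)^{\tilde k}),\,\mathcal N(X\tilde W)}\qquad\text{and}\qquad \mathcal R(Y)\subseteq\mathcal R(B^* ).$$
   Context: $\mathcal R(\cdot)$ and $\mathcal N(\cdot)$ denote range and null space; $B^*$ is the conjugate transpose and $B^{\dagger}$ the Moore-Penrose inverse. $P_{E,F}$ denotes the (oblique) projection, i.e. the idempotent matrix with range $E$ and null space $F$. For a square complex matrix $T$, $\mathrm{ind}(T)$ is the smallest nonnegative integer $k$ with $\mathrm{rank}(T^k)=\mathrm{rank}(T^{k+1})$ (with $T^0=I$). For $\tilde k=\mathrm{ind}(B\tilde W)$, a matrix $X\in\mathbb{C}^{m\times n}$ is a minimal rank $W$-weighted weak Drazin inverse of $B$ (with respect to the weight $\tilde W$) if $X\tilde W(B\tilde W)^{\tilde k+1}=(B\tilde W)^{\tilde k}$ and $\mathrm{rank}(X)=\mathrm{rank}((B\tilde W)^{\tilde k})$. *)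

(* Defs.v *)
From mathcomp Require Import all_boot all_order all_algebra.
From mathcomp Require Import sesquilinear spectral.
From mathcomp Require Import boolp classical_sets.

Set Implicit Arguments.
Unset Strict Implicit.
Unset Printing Implicit Defensive.

Import Order.TTheory GRing.Theory Num.Theory.
Local Open Scope ring_scope.
Local Open Scope sesquilinear_scope.
Local Open Scope classical_set_scope.

(* MathComp's mxalgebra works with row spaces; here R(A) and N(A) are the
   usual subspaces of column vectors, matrices acting on the left. *)
Definition mxrange (F : fieldType) (m n : nat) (A : 'M[F]_(m, n)) :
  set 'cV[F]_m := range (fun x : 'cV[F]_n => A *m x).

Definition mxnull (F : fieldType) (m n : nat) (A : 'M[F]_(m, n)) :
  set 'cV[F]_n := [set x | A *m x = 0].

(* P = P_{E,F}.  There is no such P unless E and F are complementary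
   subspaces, in which case P is unique. *)
Definition is_projector (K : fieldType) (m : nat) (P : 'M[K]_m)
    (E F : set 'cV[K]_m) : Prop :=
  [/\ P *m P = P, mxrange P = E & mxnull P = F].

Section Index.
Variables (F : fieldType) (m : nat) (T : 'M[F]_m).

Lemma mxindex_exists : exists k, \rank (T ^+ k) == \rank (T ^+ k.+1).
Proof.
have le_rank k : (\rank (T ^+ k.+1) <= \rank (T ^+ k))%N.
  by rewrite exprSr mxrankM_maxl.
apply: contrapT => noex.
have lt_rank k : (\rank (T ^+ k.+1) < \rank (T ^+ k))%N.
  rewrite ltn_neqAle le_rank andbT eq_sym; apply/negP => eqk.
  by apply: noex; exists k.
have bound k : (k + \rank (T ^+ k) <= m)%N.
  elim: k => [|k IHk]; first exact: rank_leq_row.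
  by apply: leq_trans IHk; rewrite addSnnS leq_add2l lt_rank.
by have := leq_trans (leq_addr _ _) (bound m.+1); rewrite ltnn.
Qed.

Definition mxindex : nat := ex_minn mxindex_exists.

End Index.

Section MoorePenrose.
Variable C : numClosedFieldType.

Definition penrose (m n : nat) (A : 'M[C]_(m, n)) (X : 'M[C]_(n, m)) : bool :=
  [&& A *m X *m A == A, X *m A *m X == X,
      (A *m X) ^t* == A *m X & (X *m A) ^t* == X *m A].

Lemma ctmxM (m n p : nat) (A : 'M[C]_(m, n)) (B : 'M[C]_(n, p)) :
  (A *m B) ^t* = B ^t* *m A ^t*.
Proof. by rewrite trmx_mul map_mxM. Qed.

Lemma mulmx_ctmx_eq0 (n : nat) (u : 'rV[C]_n) : u *m u ^t* = 0 -> u = 0.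
Proof.
move=> /matrixP /(_ 0 0); rewrite !mxE => sum0.
have ge0 j : true -> 0 <= u 0 j * u ^t* j 0.
  by rewrite !mxE mul_conjC_ge0.
apply/rowP => j; rewrite mxE; apply/eqP; rewrite -mul_conjC_eq0.
by move/psumr_eq0P: sum0 => /(_ ge0 j isT); rewrite !mxE => ->.
Qed.

Lemma gram_unitmx (r n : nat) (G : 'M[C]_(r, n)) :
  row_free G -> G *m G ^t* \in unitmx.
Proof.
move=> freeG; rewrite -row_free_unit -kermx_eq0; apply/rowV0P => v.
move/sub_kermxP; rewrite mulmxA => vGG.
have /mulmx_ctmx_eq0 vG0 : (v *m G) *m (v *m G) ^t* = 0.
  by rewrite ctmxM mulmxA vGG mul0mx.
by apply: (row_free_inj freeG); rewrite mul0mx.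
Qed.

Lemma penrose_exists (m n : nat) (A : 'M[C]_(m, n)) : exists X, penrose A X.
Proof.
have uG : row_base A *m (row_base A) ^t* \in unitmx.
  by apply: gram_unitmx; exact: row_base_free.
have uF : (col_base A) ^t* *m col_base A \in unitmx.
  have := @gram_unitmx _ _ ((col_base A) ^t*); rewrite trmxCK; apply.
  rewrite /row_free mxrank_map mxrank_tr; exact: col_base_full.
have AE := esym (mulmx_base A).
move: (\rank A) (col_base A) (row_base A) AE uG uF => r F G AE uG uF.
have hG : (G *m G ^t*) ^t* = G *m G ^t* by rewrite ctmxM trmxCK.
have hF : (F ^t* *m F) ^t* = F ^t* *m F by rewrite ctmxM trmxCK.
have hV p (M : 'M[C]_p) : M ^t* = M -> (invmx M) ^t* = invmx M.
  by move=> hM; rewrite trmx_inv map_invmx hM.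
pose X := G ^t* *m invmx (G *m G ^t*) *m (invmx (F ^t* *m F) *m F ^t*).
have AX : A *m X = F *m invmx (F ^t* *m F) *m F ^t*.
  rewrite AE /X !mulmxA -(mulmxA F G) -(mulmxA F (G *m _)) mulmxV //.
  by rewrite mulmx1.
have XA : X *m A = G ^t* *m invmx (G *m G ^t*) *m G.
  rewrite AE /X !mulmxA -(mulmxA _ (F ^t*) F).
  by rewrite -(mulmxA _ (invmx (F ^t* *m F))) mulVmx // mulmx1.
exists X; apply/and4P; split; apply/eqP.
- by rewrite AX AE !mulmxA -(mulmxA _ (F ^t*) F) -(mulmxA F) mulVmx ?mulmx1.
- rewrite XA /X !mulmxA -(mulmxA _ G (G ^t*)).
  by rewrite -(mulmxA _ (G *m G ^t*)) mulmxV ?mulmx1.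
- by rewrite AX !ctmxM trmxCK hV // mulmxA.
- by rewrite XA !ctmxM trmxCK hV // mulmxA.
Qed.

Definition mpinv (m n : nat) (A : 'M[C]_(m, n)) : 'M[C]_(n, m) :=
  xchoose (penrose_exists A).

Lemma mpinvP (m n : nat) (A : 'M[C]_(m, n)) : penrose A (mpinv A).
Proof. exact: xchooseP. Qed.

Lemma penrose_unique (m n : nat) (A : 'M[C]_(m, n)) (X : 'M[C]_(n, m)) :
  penrose A X -> X = mpinv A.
Proof.
have /and4P[/eqP b1 /eqP b2 /eqP b3 /eqP b4] := mpinvP A.
move: (mpinv A) b1 b2 b3 b4 => Y b1 b2 b3 b4.
move=> /and4P[/eqP a1 /eqP a2 /eqP a3 /eqP a4].
have AXY : A *m X = A *m Y.
  rewrite -a3 -{1}b1 -(mulmxA (A *m Y)) ctmxM a3 b3 mulmxA.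
  by rewrite a1.
have XYA : X *m A = Y *m A.
  rewrite -a4 -{1}b1 -(mulmxA A Y) (mulmxA X) ctmxM a4 b4.
  by rewrite -(mulmxA Y) (mulmxA A) a1.
by rewrite -a2 XYA -mulmxA AXY mulmxA b2.
Qed.

End MoorePenrose.

Definition min_rank_weak_drazin (F : fieldType) (m n : nat)
    (B : 'M[F]_(m, n)) (W : 'M[F]_(n, m)) (X : 'M[F]_(m, n)) : Prop :=
  let k := mxindex (B *m W) in
  X *m W *m (B *m W) ^+ k.+1 = (B *m W) ^+ k /\
  \rank X = \rank ((B *m W) ^+ k).

(* Main.v *)
Require Import Defs.
From mathcomp Require Import all_boot all_order all_algebra.
From mathcomp Require Import sesquilinear spectral complex.
From mathcomp Require Import boolp classical_sets reals.

(* Put T = BW and k = ind(T).  Since T^k = X (W T^(k+1)) and X has the rank of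
   T^k, X and T^k have the same range, so XWT, which fixes T^k, fixes X.  Hence
   BY = TXW is idempotent, with the null space of XW because XW (TXW) = XW.
   For uniqueness, B^dagger B fixes every Y with range inside that of B^*, so
   such a Y is recovered from BY. *)

Set Implicit Arguments.
Unset Strict Implicit.
Unset Printing Implicit Defensive.

Local Open Scope ring_scope.
Local Open Scope sesquilinear_scope.
Local Open Scope classical_set_scope.
Local Open Scope complex_scope.

Import GRing.Theory.

Section ColumnSpaces.
Variable F : fieldType.

Lemma mxrangeMl (m n p : nat) (A : 'M[F]_(m, n)) (D : 'M[F]_(n, p)) :
  mxrange (A *m D) `<=` mxrange A.
Proof. by move=> _ [x _ <-]; exists (D *m x); rewrite ?mulmxA. Qed.

(** Transposition turns column spaces into row spaces, where [submxP] supplies the factor; the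
    inclusion is tested on the columns of [A]. *)
Lemma mxrange_subP (m n p : nat) (A : 'M[F]_(m, n)) (D : 'M[F]_(m, p)) :
  mxrange A `<=` mxrange D <-> exists Z, A = D *m Z.
Proof.
split=> [AD|[Z ->]]; last exact: mxrangeMl.
suff /submxP[Z AZ] : (A^T <= D^T)%MS.
  by exists Z^T; rewrite -[A]trmxK AZ trmx_mul trmxK.
apply/row_subP => j; rewrite -tr_col.
have [|x _ xE] := AD (col j A).
  by exists (delta_mx j 0); rewrite ?colE.
by rewrite -xE trmx_mul submxMl.
Qed.

(** The range of [A *m D] lies in that of [A], so equal ranks make the two ranges coincide. *)
Lemma mulmx_rank_factor (m n p : nat) (A : 'M[F]_(m, n)) (D : 'M[F]_(n, p)) :
  \rank (A *m D) = \rank A -> exists Z, A = A *m D *m Z.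
Proof.
move=> rkAD.
have sAD : ((A *m D)^T <= A^T)%MS by rewrite trmx_mul submxMl.
have : (A^T <= (A *m D)^T)%MS.
  by rewrite -(mxrank_leqif_sup sAD) !mxrank_tr rkAD.
by case/submxP=> Z AZ; exists Z^T; rewrite -[LHS]trmxK AZ trmx_mul trmxK.
Qed.

Lemma is_projector_unique (m : nat) (P Q : 'M[F]_m) (E N : set 'cV[F]_m) :
  is_projector P E N -> is_projector Q E N -> P = Q.
Proof.
case=> PP PE PN [QQ QE QN].
have [Z PZ] : exists Z, P = Q *m Z by apply/mxrange_subP; rewrite PE QE.
have QP : Q *m P = P by rewrite PZ mulmxA QQ.
(* The columns of 1 - P lie in N(P) = N(Q), so Q (1 - P) = 0. *)
have QPQ : Q *m P = Q.
  apply/esym/eqP; rewrite -subr_eq0; apply/eqP/matrixP => i j.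
  have : mxnull Q (col j (1%:M - P)).
    by rewrite QN -PN /mxnull /= colE mulmxA mulmxBr mulmx1 PP subrr mul0mx.
  rewrite /mxnull /= colE mulmxA mulmxBr mulmx1 -colE.
  by move=> /colP/(_ i); rewrite !mxE.
by rewrite -QP QPQ.
Qed.

Lemma mxrank_mxindex (m : nat) (T : 'M[F]_m) :
  \rank (T ^+ (mxindex T).+1) = \rank (T ^+ mxindex T).
Proof. by rewrite /mxindex; case: ex_minnP => k /eqP. Qed.

(** This is the product [B *m Y] of the theorem after the cancellation $B B^\dagger B = B$; without
    adjoints, the argument works over any field. *)
Lemma min_rank_weak_drazin_projector (m n : nat) (B : 'M[F]_(m, n))
    (W : 'M[F]_(n, m)) (X : 'M[F]_(m, n)) :
  min_rank_weak_drazin B W X ->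
  is_projector (B *m W *m X *m W)
    (mxrange ((B *m W) ^+ mxindex (B *m W))) (mxnull (X *m W)).
Proof.
rewrite /min_rank_weak_drazin; have := mxrank_mxindex (B *m W).
move: (mxindex _) => k; move: (B *m W) => T rkT [XWT rkX].
have TS : T ^+ k.+1 = T *m T ^+ k by exact: exprS.
have TSr : T ^+ k.+1 = T ^+ k *m T by exact: exprSr.
have [Z TZ] : exists Z, T ^+ k = T ^+ k.+1 *m Z.
  by rewrite TSr; apply: mulmx_rank_factor; rewrite -TSr.
have [V XV] : exists V, X = T ^+ k *m V.
  have XTk : X *m (W *m T ^+ k.+1) = T ^+ k by rewrite mulmxA.
  by rewrite -XTk; apply: mulmx_rank_factor; rewrite XTk.
have XWTX : X *m W *m T *m X = X.
  by rewrite [X in _ *m X = X]XV mulmxA -(mulmxA (X *m W)) -TS XWT.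
have XWP : X *m W *m (T *m X *m W) = X *m W by rewrite !mulmxA XWTX.
split.
- by rewrite -{1}(mulmxA T X) -(mulmxA T) XWP mulmxA.
- apply/seteqP; split; apply/mxrange_subP.
    by exists (T *m V *m W); rewrite XV !mulmxA -TS TSr.
  (* The witness comes from $T^k = T^{k+1}Z = T(XWT^{k+1})Z$. *)
  by exists (T ^+ k.+1 *m Z); rewrite mulmxA -(mulmxA T X) -(mulmxA T) XWT -TS.
- apply/seteqP; split=> x; rewrite /mxnull /= => x0.
    by rewrite -XWP -mulmxA x0 mulmx0.
  by rewrite -(mulmxA T) -(mulmxA T) x0 mulmx0.
Qed.

End ColumnSpaces.

Section Adjoint.
Variable C : numClosedFieldType.

(** Since $B^\dagger B$ is Hermitian, $B^\dagger B B^* = (B B^\dagger B)^* = B^*$. *)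
Lemma mpinv_mulK_ctmx (m n p : nat) (B : 'M[C]_(m, n)) (Y : 'M[C]_(n, p)) :
  mxrange Y `<=` mxrange (B ^t*) -> mpinv B *m B *m Y = Y.
Proof.
case/mxrange_subP=> Z ->; have /and4P[/eqP BXB _ _ /eqP hXB] := mpinvP B.
by rewrite mulmxA -hXB -ctmxM mulmxA BXB.
Qed.

(** Being Hermitian, $B^\dagger B$ equals $B^* (B^\dagger)^*$. *)
Lemma mxrange_mpinv_mul (m n : nat) (B : 'M[C]_(m, n)) :
  mxrange (mpinv B *m B) `<=` mxrange (B ^t*).
Proof.
have /and4P[_ _ _ /eqP <-] := mpinvP B.
by rewrite ctmxM; exact: mxrangeMl.
Qed.

End Adjoint.

Theorem theorem3p8 (R : realType) (m n : nat)
    (B : 'M[R[i]]_(m, n)) (W : 'M[R[i]]_(n, m)) (X : 'M[R[i]]_(m, n))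
    (hX : min_rank_weak_drazin B W X) :
  unique (fun Y : 'M[R[i]]_(n, m) =>
      is_projector (B *m Y)
        (mxrange ((B *m W) ^+ mxindex (B *m W))) (mxnull (X *m W))
      /\ mxrange Y `<=` mxrange (B ^t*))
    (mpinv B *m B *m W *m X *m W).
Proof.
have /and4P[/eqP BXB _ _ _] := mpinvP B.
have BY : B *m (mpinv B *m B *m W *m X *m W) = B *m W *m X *m W.
  by rewrite !mulmxA BXB.
have projY := min_rank_weak_drazin_projector hX.
split=> [|Y [projBY /mpinv_mulK_ctmx <-]].
  split; first by rewrite BY.
  rewrite -!(mulmxA (mpinv B *m B)).
  exact: subset_trans (@mxrangeMl _ _ _ _ _ _) (@mxrange_mpinv_mul _ _ _ B).
(* The competitor is now written $B^\dagger (BY)$, and [B *m Y] must be the projector $BWXW$. *)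
by rewrite -[RHS]mulmxA -(is_projector_unique projY projBY) !mulmxA.
Qed.
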